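(* For every integer $n\geq 7$, the compact group ${\rm Spin}(n)$ is not acceptable. That is, for each $n \geq 7$ there exist a group $\Gamma$ and group morphisms $r,r' : \Gamma \rightarrow {\rm Spin}(n)$ such that $r(\gamma)$ and $r'(\gamma)$ are conjugate in ${\rm Spin}(n)$ for all $\gamma\in\Gamma$, but $r'$ is not ${\rm Spin}(n)$-conjugate to $r$.
   Context: Let $G$ be a compact group and $\Gamma$ an arbitrary (abstract) group. A group morphism $r:\Gamma\to G$ is called unacceptable if there is a group morphism $r':\Gamma\to G$ such that (U1) for all $\gamma\in\Gamma$, $r(\gamma)$ and $r'(\gamma)$ are conjugate in $G$, and (U2) $r'$ is not $G$-conjugate to $r$, i.e. there is no $g\in G$ with $r'(\gamma)=g\,r(\gamma)\,g^{-1}$ for all $\gamma$. Otherwise $r$ is called acceptable. The group $G$ is called acceptable if every group morphism $\Gamma\to G$, for every group $\Gamma$, is acceptable. ${\rm Spin}(n)$ denotes the compact spin group of the Euclidean space $\mathbb{R}^n$. *)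

(* Defs.v *)
From HB Require Import structures.
From mathcomp Require Import all_boot all_order all_algebra all_fingroup.
From mathcomp Require Import boolp reals ring.

Set Implicit Arguments.
Unset Strict Implicit.
Unset Printing Implicit Defensive.

Import GRing.Theory.
Local Open Scope ring_scope.

Section Acceptability.
Local Open Scope group_scope.

(* Acceptability only involves the abstract group underlying a compact group,
   so the target is an arbitrary groupType.  Between groups, a multiplicative
   map is the same thing as a group morphism. *)

Definition conjugate (G : groupType) (x y : G) : Prop :=
  exists g : G, y = g * x * g^-1.

Definition elementwise_conjugate (Gamma G : groupType)
    (r r' : {multiplicative Gamma -> G}) : Prop :=
  forall c : Gamma, conjugate (r c) (r' c).

Definition globally_conjugate (Gamma G : groupType)
    (r r' : {multiplicative Gamma -> G}) : Prop :=
  exists g : G, forall c : Gamma, r' c = g * r c * g^-1.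

Definition unacceptable_morphism (Gamma G : groupType)
    (r : {multiplicative Gamma -> G}) : Prop :=
  exists r' : {multiplicative Gamma -> G},
    elementwise_conjugate r r' /\ ~ globally_conjugate r r'.

Definition acceptable_morphism (Gamma G : groupType)
    (r : {multiplicative Gamma -> G}) : Prop := ~ unacceptable_morphism r.

Definition acceptable_group (G : groupType) : Prop :=
  forall (Gamma : groupType) (r : {multiplicative Gamma -> G}),
    acceptable_morphism r.

End Acceptability.

(* The Clifford algebra of R^n with its standard quadratic form
   q(v) = \sum_i v_i ^ 2, with the convention v * v = q(v) (the opposite sign
   leads to an isomorphic Spin group).  It is realised on the basis
   (e_S)_{S \subset 'I_n}, where e_S is the product of the generators e_i,
   i \in S, taken in increasing order, so that
     e_S * e_T = (-1) ^ #{(i, j) in S x T | j < i} e_(S (+) T).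
   The lemmas clifford_gen_sqr, clifford_gen_anticomm, clifford_vec_sqr and
   clifford_basis_prod below check this presentation. *)

Section SymDiff.
Variable n : nat.
Implicit Types S T U : {set 'I_n}.

Definition symdiff S T : {set 'I_n} := (S :\: T) :|: (T :\: S).

Lemma in_symdiff S T i : (i \in symdiff S T) = (i \in S) (+) (i \in T).
Proof. by rewrite !inE; do 2!case: (i \in _). Qed.

Lemma symdiffA : associative symdiff.
Proof. by move=> S T U; apply/setP=> i; rewrite !in_symdiff addbA. Qed.

Lemma symdiffC : commutative symdiff.
Proof. by move=> S T; apply/setP=> i; rewrite !in_symdiff addbC. Qed.

Lemma symdiff0s : left_id set0 symdiff.
Proof. by move=> S; apply/setP=> i; rewrite in_symdiff in_set0. Qed.

Lemma symdiffss S : symdiff S S = set0.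
Proof. by apply/setP=> i; rewrite in_symdiff in_set0 addbb. Qed.

Lemma symdiffK S : involutive (symdiff S).
Proof. by move=> T; rewrite symdiffA symdiffss symdiff0s. Qed.

Lemma symdiffs0 : right_id set0 symdiff.
Proof. by move=> S; rewrite symdiffC symdiff0s. Qed.

End SymDiff.

Section Clifford.
Variables (R : comNzRingType) (n : nat).
Implicit Types S T U : {set 'I_n}.

Definition clifford_sign S T : R :=
  \prod_(i in S) \prod_(j in T | (j < i)%N) -1.

Lemma prod_symdiff (F : 'I_n -> R) S T : (forall i, F i * F i = 1) ->
  \prod_(i in symdiff S T) F i = (\prod_(i in S) F i) * \prod_(i in T) F i.
Proof.
move=> FF; rewrite 3!(big_mkcond (fun i => i \in _)) -big_split /=.
apply: eq_bigr => i _; rewrite in_symdiff.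
by do 2!case: (i \in _); rewrite /= ?mulr1 ?mul1r ?FF.
Qed.

Lemma clifford_sign_sqr S T : clifford_sign S T * clifford_sign S T = 1.
Proof.
rewrite /clifford_sign -big_split /= big1 // => i _.
by rewrite -big_split /= big1 // => j _; rewrite mulrNN mulr1.
Qed.

Lemma clifford_signDl S S' T : clifford_sign (symdiff S S') T =
  clifford_sign S T * clifford_sign S' T.
Proof.
apply: prod_symdiff => i.
by rewrite -big_split /= big1 // => j _; rewrite mulrNN mulr1.
Qed.

Lemma clifford_signDr S T T' : clifford_sign S (symdiff T T') =
  clifford_sign S T * clifford_sign S T'.
Proof.
rewrite /clifford_sign -big_split /=; apply: eq_bigr => i _.
rewrite 3!big_mkcondr /=; apply: prod_symdiff => j.
by case: ifP; rewrite ?mulrNN mulr1.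
Qed.

Lemma clifford_sign0s T : clifford_sign set0 T = 1.
Proof. by rewrite /clifford_sign big_set0. Qed.

Lemma clifford_signs0 S : clifford_sign S set0 = 1.
Proof.
by rewrite /clifford_sign big1 // => i _; rewrite big_pred0 // => j; rewrite inE.
Qed.

Definition clifford : Type := {ffun {set 'I_n} -> R^o}.

HB.instance Definition _ := GRing.Lmodule.on clifford.

Implicit Types x y z : clifford.

Definition clifford_basis S : clifford := [ffun T => (T == S)%:R].

(* For each S, the only T with S (+) T = U is S (+) U. *)
Definition clifford_mul x y : clifford :=
  [ffun U => \sum_(S : {set 'I_n})
     clifford_sign S (symdiff S U) * (x S * y (symdiff S U))].

Lemma clifford_mulA : associative clifford_mul.
Proof.
move=> x y z; apply/ffunP=> U; rewrite !ffunE.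
under eq_bigr do rewrite ffunE 2!mulr_sumr.
under [in RHS]eq_bigr do rewrite ffunE mulr_suml mulr_sumr.
rewrite [RHS]exchange_big /=; apply: eq_bigr => T _.
rewrite [RHS](reindex_inj (can_inj (symdiffK T))) /=; apply: eq_bigr => S _.
rewrite !symdiffK.
have -> : symdiff (symdiff T S) U = symdiff S (symdiff T U).
  by rewrite [symdiff T S]symdiffC symdiffA.
set W := symdiff T U.
have eTU : clifford_sign T W =
    clifford_sign T S * clifford_sign T (symdiff S W).
  by rewrite -clifford_signDr symdiffK.
rewrite eTU clifford_signDl.
ring.
Qed.

Lemma clifford_mul1l : left_id (clifford_basis set0) clifford_mul.
Proof.
move=> x; apply/ffunP=> U; rewrite ffunE (bigD1 set0) //= big1 ?addr0.
  by rewrite ffunE eqxx symdiff0s clifford_sign0s !mul1r.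
by move=> S /negPf S0; rewrite ffunE S0 mul0r mulr0.
Qed.

Lemma clifford_mul1r : right_id (clifford_basis set0) clifford_mul.
Proof.
move=> x; apply/ffunP=> U; rewrite ffunE (bigD1 U) //= big1 ?addr0.
  by rewrite symdiffss ffunE eqxx clifford_signs0 mul1r mulr1.
move=> S SU; rewrite ffunE; case: eqP => [e|_]; last by rewrite !mulr0.
by case/eqP: SU; rewrite -[RHS](symdiffK S) e symdiffs0.
Qed.

Lemma clifford_mulDl : left_distributive clifford_mul +%R.
Proof.
move=> x y z; apply/ffunP=> U; rewrite !ffunE -big_split /=.
by apply: eq_bigr => S _; rewrite ffunE mulrDl mulrDr.
Qed.

Lemma clifford_mulDr : right_distributive clifford_mul +%R.
Proof.
move=> x y z; apply/ffunP=> U; rewrite !ffunE -big_split /=.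
by apply: eq_bigr => S _; rewrite ffunE !mulrDr.
Qed.

Lemma clifford_1neq0 : clifford_basis set0 != 0.
Proof. by apply/eqP=> /ffunP/(_ set0)/eqP; rewrite !ffunE eqxx oner_eq0. Qed.

HB.instance Definition _ := GRing.Zmodule_isNzRing.Build clifford
  clifford_mulA clifford_mul1l clifford_mul1r clifford_mulDl clifford_mulDr
  clifford_1neq0.

Lemma clifford_scalerAl (a : R) x y : a *: (x * y) = a *: x * y.
Proof.
apply/ffunP=> U; rewrite !ffunE scaler_sumr; apply: eq_bigr => S _.
by rewrite ffunE /GRing.scale /=; ring.
Qed.

HB.instance Definition _ :=
  GRing.Lmodule_isLalgebra.Build R clifford clifford_scalerAl.

Lemma clifford_scalerAr (a : R) x y : a *: (x * y) = x * (a *: y).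
Proof.
apply/ffunP=> U; rewrite !ffunE scaler_sumr; apply: eq_bigr => S _.
by rewrite ffunE /GRing.scale /=; ring.
Qed.

HB.instance Definition _ :=
  GRing.Lalgebra_isAlgebra.Build R clifford clifford_scalerAr.

Lemma clifford_basisM S T :
  clifford_basis S * clifford_basis T =
  clifford_sign S T *: clifford_basis (symdiff S T).
Proof.
apply/ffunP=> U; rewrite !ffunE (bigD1 S) //= big1 ?addr0; last first.
  by move=> V /negPf VS; rewrite ffunE VS mul0r mulr0.
rewrite !ffunE eqxx mul1r (can2_eq (symdiffK S) (symdiffK S)) /GRing.scale /=.
by case: eqP => [->|_]; rewrite ?symdiffK // !mulr0.
Qed.

Definition clifford_gen (i : 'I_n) : clifford := clifford_basis [set i].

(* The inclusion of the Euclidean space R^n in its Clifford algebra. *)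
Definition clifford_vec (v : 'rV[R]_n) : clifford :=
  \sum_i v 0 i *: clifford_gen i.

Lemma clifford_sign1 i j :
  clifford_sign [set i] [set j] = if (j < i)%N then -1 else 1.
Proof.
rewrite /clifford_sign big_set1 big_mkcondr big_set1.
by case: ifP.
Qed.

Lemma clifford_gen_sqr i : clifford_gen i * clifford_gen i = 1.
Proof. by rewrite clifford_basisM symdiffss clifford_sign1 ltnn scale1r. Qed.

Lemma clifford_gen_anticomm i j : i != j ->
  clifford_gen i * clifford_gen j = - (clifford_gen j * clifford_gen i).
Proof.
rewrite !clifford_basisM [symdiff [set j] _]symdiffC !clifford_sign1 -scaleNr.
by rewrite neq_ltn => /orP[] ij; rewrite ij ltnNge ltnW //= ?opprK.
Qed.

Lemma sum_antisym (F : 'I_n -> 'I_n -> clifford) :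
  (forall i j, i != j -> F i j = - F j i) ->
  \sum_i \sum_j F i j = \sum_i F i i.
Proof.
move=> FN; transitivity (\sum_i F i i +
    (\sum_(i < n) \sum_(j < n | (i < j)%N) F i j +
     \sum_(i < n) \sum_(j < n | (j < i)%N) F i j)).
  rewrite -!big_split; apply: eq_bigr => i _ /=.
  rewrite (bigD1 i) //= (bigID (fun j : 'I_n => (i < j)%N)) /=.
  by congr (_ + (_ + _)); apply: eq_bigl => j; rewrite -val_eqE /=;
    case: ltngtP.
rewrite [X in _ + (_ + X)](exchange_big_dep xpredT) //= -big_split /=.
rewrite [X in _ + X]big1 ?addr0 // => i _; rewrite -big_split big1 //= => j ij.
by rewrite FN ?addNr // neq_ltn ij.
Qed.

Lemma clifford_vec_sqr v :
  clifford_vec v * clifford_vec v = (\sum_i v 0 i ^+ 2)%:A.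
Proof.
rewrite /clifford_vec mulr_suml scaler_suml.
under eq_bigr do rewrite mulr_sumr.
rewrite sum_antisym => [|i j ij].
  apply: eq_bigr => i _.
  by rewrite -scalerAl -scalerAr scalerA clifford_gen_sqr expr2.
rewrite -!scalerAl -!scalerAr !scalerA clifford_gen_anticomm // scalerN.
by rewrite [v 0 i * _]mulrC.
Qed.

(* 'enum S' lists S in increasing order. *)
Lemma clifford_basis_prod S :
  clifford_basis S = \prod_(i <- enum S) clifford_gen i.
Proof.
have gen s : sorted (fun i j : 'I_n => (i < j)%N) s ->
    \prod_(i <- s) clifford_gen i = clifford_basis [set i in s].
  elim: s => [_|i s IHs srt].
    by rewrite big_nil; congr clifford_basis; apply/setP=> j; rewrite !inE.
  have := srt; rewrite /= (path_sortedE (fun _ _ _ => @ltn_trans _ _ _)).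
  case/andP=> /allP lti /IHs; rewrite big_cons => ->.
  have iNs : i \notin s by apply/negP=> /lti; rewrite ltnn.
  rewrite clifford_basisM [X in X *: _]big_set1 big1.
    rewrite scale1r; congr clifford_basis; apply/setP=> j.
    rewrite in_symdiff !inE; case: eqP => [->|_]; last by case: (_ \in _).
    by rewrite (negPf iNs).
  by move=> j; rewrite inE => /andP[/lti /ltnW]; rewrite leqNgt => /negPf ->.
rewrite gen; first by congr clifford_basis; apply/setP=> i; rewrite inE mem_enum.
rewrite {1}/enum_mem -enumT /=.
apply: sorted_filter; first by move=> ? ? ?; apply: ltn_trans.
by rewrite -(sorted_map (f := val) (e' := ltn)) val_enum_ord iota_ltn_sorted.
Qed.

End Clifford.

Section SpinGroup.
Variables (R : realType) (n : nat).

Definition unit_vector (v : 'rV[R]_n) : Prop := \sum_i v 0 i ^+ 2 = 1.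

(* Spin(n) is the group of all products of an even number of unit vectors in
   the Clifford algebra. *)
Definition spin_pred : pred (clifford R n) := fun x =>
  `[< exists s : seq 'rV[R]_n,
      [/\ forall v, v \in s -> unit_vector v,
          ~~ odd (size s) &
          x = \prod_(v <- s) clifford_vec v] >].

Record Spin : Type := MkSpin {
  spin_val :> clifford R n;
  _ : spin_pred spin_val }.

HB.instance Definition _ := [isSub for spin_val].
HB.instance Definition _ := [Choice of Spin by <:].

Implicit Types x y z : Spin.

Lemma spin_pred1 : spin_pred 1.
Proof. by apply/asboolP; exists [::]; split=> //; rewrite big_nil. Qed.

Lemma spin_predM (a b : clifford R n) :
  spin_pred a -> spin_pred b -> spin_pred (a * b).
Proof.
move=> /asboolP[s [us os ->]] /asboolP[t [ut ot ->]].
apply/asboolP; exists (s ++ t); split; last by rewrite big_cat.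
  by move=> v; rewrite mem_cat => /orP[/us|/ut].
by rewrite size_cat oddD negb_add (negPf os) (negPf ot).
Qed.

Lemma unit_vectors_prod_rev (s : seq 'rV[R]_n) :
  (forall v, v \in s -> unit_vector v) ->
  (\prod_(v <- rev s) clifford_vec v) * (\prod_(v <- s) clifford_vec v) = 1.
Proof.
elim: s => [|v s IHs] us; first by rewrite !big_nil mulr1.
rewrite rev_cons -cats1 big_cat big_seq1 big_cons /= -mulrA.
rewrite [clifford_vec v * _]mulrA clifford_vec_sqr (us v) ?mem_head //.
by rewrite scale1r mul1r IHs // => w sw; apply: us; rewrite in_cons sw orbT.
Qed.

Definition spin_one : Spin := MkSpin spin_pred1.

Definition spin_mul x y : Spin :=
  MkSpin (spin_predM (valP x) (valP y)).

Lemma spin_inv_ex x :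
  exists y, val y * val x = 1 /\ val x * val y = 1.
Proof.
case: x => x /= px; have /asboolP[s [us os xs]] := px.
have ur v : v \in rev s -> unit_vector v by rewrite mem_rev; apply: us.
have pr : spin_pred (\prod_(v <- rev s) clifford_vec v).
  by apply/asboolP; exists (rev s); rewrite size_rev.
exists (MkSpin pr); rewrite xs /= unit_vectors_prod_rev //; split=> //.
by rewrite -{1}(revK s) unit_vectors_prod_rev.
Qed.

Definition spin_inv x : Spin := projT1 (cid (spin_inv_ex x)).

Lemma spin_mulA : associative spin_mul.
Proof. by move=> x y z; apply/val_inj; rewrite /= mulrA. Qed.

Lemma spin_mul1l : left_id spin_one spin_mul.
Proof. by move=> x; apply/val_inj; rewrite /= mul1r. Qed.

Lemma spin_mul1r : right_id spin_one spin_mul.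
Proof. by move=> x; apply/val_inj; rewrite /= mulr1. Qed.

Lemma spin_mulVl : left_inverse spin_one spin_inv spin_mul.
Proof.
by move=> x; apply/val_inj; rewrite /spin_inv; case: cid => y [].
Qed.

Lemma spin_mulVr : right_inverse spin_one spin_inv spin_mul.
Proof.
by move=> x; apply/val_inj; rewrite /spin_inv; case: cid => y [].
Qed.

HB.instance Definition _ := isGroup.Build Spin
  spin_mulA spin_mul1l spin_mul1r spin_mulVl spin_mulVr.

End SpinGroup.

(* Main.v *)
Require Import Defs.
From HB Require Import structures.
From mathcomp Require Import all_boot all_order all_algebra all_fingroup.
From mathcomp Require Import boolp reals.
From mathcomp Require Import ring.

(** Let e_0, ..., e_6 be the first seven generators of the Clifford algebra,
and put x = e_0 e_1, y = e_2 e_3, z = e_4 e_5.  These are commuting square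
roots of -1.  Take Gamma = Z/4 x Z/4 and the commuting elements

    a = (1/2) (1 + x) (1 + y) z,    b = y

of Spin(n), both of order 4.  In SO(n), a turns the planes (e_0, e_1) and
(e_2, e_3) by a right angle and is -1 on (e_4, e_5), while b is -1 on
(e_2, e_3).  Put r(j, k) = a^j b^k and r'(j, k) = a^j b^-k.  Since b^2 = -1,
the two maps agree for even k and differ by the central sign -1 for odd k.

They are conjugate element by element: an element of Spin(n) lying over a
rotation that has both eigenvalues 1 and -1 is conjugate to its opposite, by
the product of a vector fixed by the rotation and a vector that it negates.
For odd k the rotation below r(j, k) has the eigenvalue -1, on (e_4, e_5) if j
is odd and on one of the first two planes if j is even; the vector e_6 is
always fixed, and this is where n >= 7 enters.  So the conjugators are e_4 e_6,
e_2 e_6 and e_0 e_6.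

They are not globally conjugate.  Suppose that g commutes with a and
anticommutes with b = y.  As a^2 b = x, also g x = - x g, so moving g through
a exchanges (1 + x) (1 + y) with (1 - x) (1 - y), and comparison with g a = a g
leaves g z g^-1 = x y z (turn_flip).  But conjugation by an element of Spin(n)
maps vectors to vectors, so g z g^-1 is a product of two vectors and has no
component on the basis element e_0 e_1 e_2 e_3 e_4 e_5 (spin_pair_swap), which
is x y z up to sign. *)

Set Implicit Arguments.
Unset Strict Implicit.
Unset Printing Implicit Defensive.

Import GRing.Theory Num.Theory.
Local Open Scope ring_scope.

(** * Morphisms from Z/4 x Z/4 *)

Section CommutingPair.
Local Open Scope group_scope.
Variables (G : groupType) (p q : nat) (a b : G).
Hypotheses (ab : commute a b) (ap : a ^+ p.+1 = 1) (bq : b ^+ q.+1 = 1).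

Lemma expg_modn (x : G) (m k : nat) : x ^+ m = 1 -> x ^+ (k %% m) = x ^+ k.
Proof.
by move=> xm; rewrite {2}(divn_eq k m) expgnDr mulnC expgnA xm expg1n mul1g.
Qed.

Definition pair_map (c : 'I_p.+1 * 'I_q.+1) : G := a ^+ c.1 * b ^+ c.2.

Lemma pair_mapM : {morph pair_map : c d / c * d}.
Proof.
move=> [i j] [k l]; rewrite /pair_map /= !expg_modn // !expgnDr.
by rewrite -!mulgA; congr (_ * _); rewrite !mulgA (commuteX2 k j ab).
Qed.

HB.instance Definition _ := isMultiplicative.Build _ _ pair_map pair_mapM.

Definition pair_hom : {multiplicative 'I_p.+1 * 'I_q.+1 -> G} := pair_map.
End CommutingPair.

Section GroupCriterion.
Local Open Scope group_scope.
Variable (G : groupType).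

Lemma conjugateP (x y g : G) : g * x = y * g -> Defs.conjugate x y.
Proof. by move=> e; exists g; rewrite e mulgK. Qed.

Lemma conjugate_refl (x : G) : Defs.conjugate x x.
Proof. by apply: (@conjugateP _ _ 1); rewrite mulg1 mul1g. Qed.

Lemma conjugate_sym (x y : G) : Defs.conjugate x y -> Defs.conjugate y x.
Proof. by case=> g ->; exists g^-1; rewrite invgK !mulgA mulVg mul1g mulgVK. Qed.

Variables (a b : G).
Hypotheses (b4 : b ^+ 4 = 1)
  (cab : forall j, (j < 4)%N -> Defs.conjugate (a ^+ j * b) (a ^+ j * b^-1)).

(** Since b^2 = b^-2 and b^3 = b^-1, the exponents of b reduce to 0 and 1, up
to exchanging the two sides. *)
Lemma conjugate_pair_hom (c : 'I_4 * 'I_4) :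
  Defs.conjugate (a ^+ c.1 * b ^+ c.2) (a ^+ c.1 * b^-1 ^+ c.2).
Proof.
have b22 : b^-1 ^+ 2 = b ^+ 2.
  by rewrite expVgn; apply: mulg1_eq; rewrite -expgnDr.
have b3 : b ^+ 3 = b^-1 by apply/esym/mulg1_eq; rewrite -expgS.
case: c => -[i i4] [[|[|[|[|k]]]] //= k4]; first exact: conjugate_refl.
- exact: cab.
- by rewrite b22; apply: conjugate_refl.
- by rewrite expVgn b3 invgK; apply/conjugate_sym/cab.
Qed.

End GroupCriterion.

(** * Commuting square roots of -1 *)

Section Algebra.
Variable A : nzRingType.
Implicit Types x y z g : A.

Lemma anti_comm x y g : g * x = - (x * g) -> GRing.comm g y ->
  g * (x * y) = - (x * y * g).
Proof. by move=> gx gy; rewrite mulrA gx mulNr -[x * g * y]mulrA gy mulrA. Qed.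

Lemma comm_anti x y g : GRing.comm g x -> g * y = - (y * g) ->
  g * (x * y) = - (x * y * g).
Proof. by move=> gx gy; rewrite mulrA gx -[LHS]mulrA gy mulrN mulrA. Qed.

Lemma anti_anti x y g : g * x = - (x * g) -> g * y = - (y * g) ->
  GRing.comm g (x * y).
Proof.
move=> gx gy; rewrite /GRing.comm mulrA gx mulNr -[x * g * y]mulrA gy.
by rewrite mulrN opprK mulrA.
Qed.

Lemma sqr_1D x : x * x = -1 -> (1 + x) * (1 + x) = x *+ 2.
Proof.
move=> xx; rewrite mulrDl mul1r mulrDr mulr1 xx [1 + x]addrC addrACA addrN.
by rewrite addr0.
Qed.

Lemma mul_1D1B x : x * x = -1 -> (1 + x) * (1 - x) = 2.
Proof. by move=> xx; rewrite mulrDl mul1r mulrBr mulr1 xx opprK addrA subrK. Qed.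

(** Moving g through (1 + x) (1 + y) turns it into (1 - x) (1 - y).  As
(1 + x) (1 - x) = 2 while (1 + x)^2 = 2 x, multiplication by (1 + x) (1 + y)
makes both sides explicit.  The factor 4 is kept because the ring is
arbitrary. *)
Lemma flip_sqrtN1 x y z g :
  x * x = -1 -> y * y = -1 ->
  GRing.comm x y ->
  g * x = - (x * g) -> g * y = - (y * g) ->
  GRing.comm g ((1 + x) * (1 + y) * z) ->
  (g * z) *+ 4 = (x * y * z * g) *+ 4.
Proof.
move=> xx yy xy gx gy gh.
have g1 u : g * u = - (u * g) -> g * (1 + u) = (1 - u) * g.
  by move=> gu; rewrite mulrDr mulrDl mulr1 mul1r gu mulNr.
have cxy : GRing.comm (1 + y) x.
  by apply/commr_sym/commrD => //; apply: commr1.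
have hL : (1 + y) * ((1 + x) * ((1 - x) * (1 - y))) = 4.
  by rewrite [(1 + x) * _]mulrA mul_1D1B // mulr_natl mulrnAr mul_1D1B //
    -mulrnA.
have hR : (1 + y) * ((1 + x) * ((1 + x) * (1 + y))) = (x * y) *+ 4.
  rewrite [(1 + x) * _]mulrA sqr_1D // mulrnAl mulrnAr mulrA cxy -mulrA.
  by rewrite sqr_1D // mulrnAr -mulrnA.
have e : (1 - x) * (1 - y) * (g * z) = (1 + x) * (1 + y) * (z * g).
  transitivity ((1 - x) * ((1 - y) * g) * z); first by rewrite !mulrA.
  by rewrite -(g1 y gy) [(1 - x) * _]mulrA -(g1 x gx) [RHS]mulrA -gh !mulrA.
rewrite -[LHS]mulr_natl -hL -!mulrA [(1 - x) * _]mulrA e.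
rewrite -[(1 + x) * _ * _]mulrA.
by rewrite !mulrA in hR *; rewrite hR !mulrnAl.
Qed.
End Algebra.

Section Turn.
Variables (F : realFieldType) (A : algType F).
Implicit Types x y z g : A.

(** For the bivectors x, y, z of three orthogonal planes, this is an element of
Spin over the rotation by a right angle in the first two planes and by a half
turn in the third. *)
Definition turn x y z : A := 2^-1 *: ((1 + x) * (1 + y) * z).

Lemma comm_1D x g : GRing.comm g x -> GRing.comm g (1 + x).
Proof. by move=> gx; apply: commrD => //; apply: commr1. Qed.

Lemma comm_scale (c : F) x g : GRing.comm g x -> GRing.comm g (c *: x).
Proof. by move=> gx; rewrite /GRing.comm -scalerAl -scalerAr gx. Qed.

Lemma turn_comm x y z g : GRing.comm g x -> GRing.comm g y -> GRing.comm g z ->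
  GRing.comm g (turn x y z).
Proof.
by move=> gx gy gz; apply/comm_scale/commrM => //; apply/commrM; apply: comm_1D.
Qed.

Lemma turn_anticomm x y z g : GRing.comm g x -> GRing.comm g y ->
  g * z = - (z * g) -> g * turn x y z = - (turn x y z * g).
Proof.
move=> gx gy gz; rewrite /turn -scalerAl -scalerAr -scalerN; congr (_ *: _).
by apply: comm_anti => //; apply: commrM; apply: comm_1D.
Qed.

(** (1 + x)^2 = 2 x, (1 + y)^2 = 2 y and z^2 = -1. *)
Lemma turn_sqr x y z : x * x = -1 -> y * y = -1 -> z * z = -1 ->
  GRing.comm x y -> GRing.comm x z -> GRing.comm y z ->
  turn x y z * turn x y z = - (x * y).
Proof.
move=> xx yy zz xy xz yz; rewrite /turn -scalerAl -scalerAr scalerA.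
have zh : GRing.comm z ((1 + x) * (1 + y)).
  by apply: commrM; apply/comm_1D/commr_sym.
have yx : GRing.comm (1 + y) (1 + x).
  by apply/comm_1D/commr_sym/comm_1D.
have hh : (1 + x) * (1 + y) * ((1 + x) * (1 + y)) = x * y *+ 4.
  rewrite -mulrA [(1 + y) * _]mulrA yx -[(1 + x) * _ * _]mulrA sqr_1D //.
  by rewrite mulrA sqr_1D // mulrnAl mulrnAr -mulrnA.
set h := (1 + x) * (1 + y) in zh hh *.
rewrite -[h * z * _]mulrA [z * _]mulrA zh -[h * z * z]mulrA zz mulrN1 mulrN hh.
rewrite scalerN -scaler_nat scalerA.
by rewrite [X in X *: _](_ : _ = 1) ?scale1r //; field.
Qed.

(** Anticommuting with y and commuting with r = turn x y z forces g to
anticommute with x as well, because x = r^2 y. *)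
Lemma turn_flip x y z g : x * x = -1 -> y * y = -1 -> z * z = -1 ->
  GRing.comm x y -> GRing.comm x z -> GRing.comm y z ->
  GRing.comm g (turn x y z) -> g * y = - (y * g) ->
  g * z = x * y * z * g.
Proof.
move=> xx yy zz xy xz yz gr gy.
have xE : x = turn x y z * turn x y z * y.
  by rewrite turn_sqr // mulNr -mulrA yy mulrN1 opprK.
have gx : g * x = - (x * g).
  by rewrite xE; apply: comm_anti => //; apply: commrM.
have gh : GRing.comm g ((1 + x) * (1 + y) * z).
  have -> : (1 + x) * (1 + y) * z = 2 *: turn x y z.
    by rewrite /turn scalerA divff ?scale1r // pnatr_eq0.
  exact: comm_scale.
have /(congr1 (fun t => 4^-1 *: t)) := flip_sqrtN1 xx yy xy gx gy gh.
rewrite -!(@scaler_nat F) !scalerA mulVf ?scale1r //.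
by rewrite pnatr_eq0.
Qed.
End Turn.

(** * Vectors and bivectors in the Clifford algebra *)

Section Vectors.
Variables (R : comNzRingType) (n : nat).
Implicit Types (v w : 'rV[R]_n) (i j k l : 'I_n).
Local Notation e := (@clifford_gen R n).

Lemma clifford_vecD v w :
  clifford_vec (v + w) = clifford_vec v + clifford_vec w.
Proof.
rewrite /clifford_vec -big_split; apply: eq_bigr => i _.
by rewrite mxE scalerDl.
Qed.

Lemma clifford_vecZ a v : clifford_vec (a *: v) = a *: clifford_vec v.
Proof.
rewrite /clifford_vec scaler_sumr; apply: eq_bigr => i _.
by rewrite mxE scalerA.
Qed.

Lemma clifford_vec_delta i : clifford_vec (delta_mx 0 i) = e i.
Proof.
rewrite /clifford_vec (bigD1 i) //= mxE !eqxx scale1r big1 ?addr0 // => j ji.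
by rewrite mxE (negPf ji) andbF scale0r.
Qed.

(** Polarization of v^2 = q(v). *)
Lemma clifford_vec_polar v w : exists c : R,
  clifford_vec v * clifford_vec w + clifford_vec w * clifford_vec v = c%:A.
Proof.
exists (\sum_i (v + w) 0 i ^+ 2 - \sum_i v 0 i ^+ 2 - \sum_i w 0 i ^+ 2).
rewrite 2!scalerBl -!clifford_vec_sqr clifford_vecD mulrDl !mulrDr.
by rewrite -[RHS]addrA -opprD [X in X + _ - _]addrC addrACA addrK.
Qed.

(** e_i e_j is a multiple of the basis element of index {i} (+) {j}, a set with
at most two elements. *)
Lemma clifford_vecM_coef v w (S : {set 'I_n}) :
  (2 < #|S|)%N -> (clifford_vec v * clifford_vec w) S = 0.
Proof.
move=> S2; rewrite /clifford_vec mulr_suml sum_ffunE big1 // => i _.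
rewrite mulr_sumr sum_ffunE big1 // => j _.
rewrite -scalerAl -scalerAr clifford_basisM !ffunE.
case: eqP => [SE|]; last by rewrite /GRing.scale /= !mulr0.
suff : (#|S| <= 2)%N by rewrite leqNgt S2.
have /subset_leq_card/leq_trans -> // : S \subset [set i; j].
  by apply/subsetP => k; rewrite SE in_symdiff !inE; do 2!case: (k == _).
by rewrite cards2; case: (_ != _).
Qed.

Lemma clifford_gen_comm_pair k i j : k != i -> k != j ->
  GRing.comm (e k) (e i * e j).
Proof. by move=> ki kj; apply: anti_anti; apply: clifford_gen_anticomm. Qed.

Lemma clifford_gen_anticomm_pair i j : i != j ->
  e i * (e i * e j) = - (e i * e j * e i).
Proof. by move=> ij; apply: comm_anti => //; apply: clifford_gen_anticomm. Qed.

Lemma clifford_pairs_comm i j k l : k != i -> k != j -> l != i -> l != j ->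
  GRing.comm (e k * e l) (e i * e j).
Proof.
by move=> *; apply/commr_sym/commrM;
  apply/commr_sym/clifford_gen_comm_pair.
Qed.

Lemma clifford_pairs_anticomm i j l : i != j -> l != i -> l != j ->
  e i * e l * (e i * e j) = - (e i * e j * (e i * e l)).
Proof.
move=> ij li lj; apply: canRL opprK _; apply/esym.
apply: anti_comm; last by apply/commr_sym/clifford_gen_comm_pair.
by rewrite clifford_gen_anticomm_pair // opprK.
Qed.

Lemma clifford_pair_sqr i j : i != j -> e i * e j * (e i * e j) = -1.
Proof.
move=> ij; rewrite -mulrA [e j * _]mulrA clifford_gen_anticomm 1?eq_sym //.
by rewrite mulNr mulrN -mulrA clifford_gen_sqr mulr1 clifford_gen_sqr.
Qed.
End Vectors.

(** The set S is {i_0, ..., i_5}, but three of its elements are enough to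
separate it from the products of two vectors. *)
Lemma clifford_gen6_coef (F : fieldType) (n : nat) (i : 'I_6 -> 'I_n) :
    injective i ->
  exists2 S : {set 'I_n}, (2 < #|S|)%N &
    (clifford_gen F (i 0) * clifford_gen F (i 1) *
     (clifford_gen F (i 2) * clifford_gen F (i 3)) *
     (clifford_gen F (i 4) * clifford_gen F (i 5))) S != 0.
Proof.
move=> inj_i.
have sgn0 (S T : {set 'I_n}) : clifford_sign F S T != 0.
  apply/eqP=> s0; have/eqP := clifford_sign_sqr F S T.
  by rewrite s0 mul0r eq_sym oner_eq0.
rewrite /clifford_gen !clifford_basisM -!scalerAl -!scalerAr !scalerA.
rewrite !clifford_basisM -!scalerAl scalerA clifford_basisM !scalerA.
set c := (X in X *: _); set S := symdiff _ _.
exists S; last first.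
  by rewrite !ffunE eqxx /GRing.scale /= mulr1 !mulf_neq0.
apply/card_gt2P; exists (i 0), (i 2), (i 4).
by rewrite !in_symdiff !inE !(inj_eq inj_i).
Qed.

(** * Elements of the spin group *)

Section SpinElements.
Variables (R : realType) (n : nat).
Implicit Types (v w : 'rV[R]_n) (i j : 'I_n) (g : Spin R n).
Local Notation e := (@clifford_gen R n).

Lemma unit_vector_delta i : unit_vector (delta_mx 0 i : 'rV[R]_n).
Proof.
rewrite /unit_vector (bigD1 i) //= big1 => [|j /negPf ji]; rewrite mxE ?ji.
  by rewrite !eqxx expr1n addr0.
by rewrite andbF expr0n.
Qed.

Lemma spin_ofP (s : seq 'rV[R]_n) : (forall v, v \in s -> unit_vector v) ->
  ~~ odd (size s) -> exists g, val g = \prod_(v <- s) clifford_vec v.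
Proof.
move=> us os.
have ps : spin_pred (\prod_(v <- s) clifford_vec v) by apply/asboolP; exists s.
by exists (MkSpin ps).
Qed.

Lemma spin_pair i j : exists g, val g = e i * e j.
Proof.
have [|//|g gE] := @spin_ofP [:: delta_mx 0 i; delta_mx 0 j].
  by move=> v; rewrite !inE => /orP[]/eqP ->; apply: unit_vector_delta.
by exists g; rewrite gE !big_cons big_nil mulr1 !clifford_vec_delta.
Qed.

(** 1 + e_i e_j = e_i (e_i + e_j), and c (e_i + e_j) is a unit vector for
c = 1 / sqrt 2; the two factors c account for the 1/2 in turn. *)
Lemma spin_turn i j k l p q : i != j -> k != l ->
  exists g, val g = turn (e i * e j) (e k * e l) (e p * e q).
Proof.
move=> ij kl; pose c : R := (Num.sqrt 2)^-1.
have cc : c * c = 2^-1 by rewrite -invfM -expr2 sqr_sqrtr // ler0n.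
pose h i j : 'rV[R]_n := c *: (delta_mx 0 i + delta_mx 0 j).
have hu a b : a != b -> unit_vector (h a b).
  move=> ab; rewrite /unit_vector (bigD1 a) //= (bigD1 b) 1?eq_sym //= big1.
    rewrite !mxE !eqxx [b == a]eq_sym (negPf ab) /= addr0 add0r !mulr1 addr0.
    by rewrite expr2 cc; field.
  move=> m /andP[/negPf ma /negPf mb].
  by rewrite !mxE ma mb /= addr0 mulr0 expr0n.
have eh a b : e a * clifford_vec (h a b) = c *: (1 + e a * e b).
  rewrite clifford_vecZ clifford_vecD !clifford_vec_delta -scalerAr.
  by rewrite mulrDr clifford_gen_sqr.
have [|//|g gE] := @spin_ofP [:: delta_mx 0 i; h i j; delta_mx 0 k; h k l;
                                delta_mx 0 p; delta_mx 0 q].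
  have [hij hkl du] := And3 (hu _ _ ij) (hu _ _ kl) unit_vector_delta.
  move=> v; rewrite !inE; do 5!(case/orP=> [/eqP-> //|]); by move/eqP->.
exists g; rewrite gE !big_cons big_nil mulr1 !clifford_vec_delta.
rewrite mulrA eh [e k * _]mulrA eh -scalerAl -scalerAl -scalerAr scalerA cc.
by rewrite mulrA.
Qed.

(** From v w + w v = c and v^2 = 1, v w v^-1 = c v - w is minus the reflection
of w. *)
Lemma unit_vector_swap v w : unit_vector v ->
  exists w', clifford_vec v * clifford_vec w = clifford_vec w' * clifford_vec v.
Proof.
move=> uv; have [c vw] := clifford_vec_polar v w.
exists (c *: v + (-1) *: w); rewrite clifford_vecD !clifford_vecZ scaleN1r.
rewrite mulrBl -scalerAl clifford_vec_sqr uv scale1r -vw.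
by rewrite addrK.
Qed.

(** The action of Spin(n) on the vectors, written without inverses so that it
goes through by induction on a factorization of g. *)
Lemma spin_swap g w :
  exists w', val g * clifford_vec w = clifford_vec w' * val g.
Proof.
case: g => /= x /asboolP[s [us _ ->]] {x}.
elim: s us => [|v s IHs] us; first by exists w; rewrite big_nil mulr1 mul1r.
have [|w1 sw] := IHs; first by move=> u su; apply: us; rewrite inE su orbT.
have [|w2 vw] := @unit_vector_swap v w1; first exact/us/mem_head.
by exists w2; rewrite big_cons -mulrA sw mulrA vw mulrA.
Qed.

Lemma spin_mulI g (x y : clifford R n) : x * val g = y * val g -> x = y.
Proof.
have [h [_ gh]] := spin_inv_ex g.
by move=> /(congr1 (fun t => t * val h)); rewrite -!mulrA gh !mulr1.
Qed.

(** x = g e_i e_j g^-1 is the product of the vectors g e_i g^-1 and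
g e_j g^-1. *)
Lemma spin_pair_swap g i j (x : clifford R n) (S : {set 'I_n}) :
  val g * (e i * e j) = x * val g -> (2 < #|S|)%N -> x S = 0.
Proof.
rewrite -!clifford_vec_delta mulrA => gx S2.
have [v gv] := spin_swap g (delta_mx 0 i).
have [w gw] := spin_swap g (delta_mx 0 j).
move: gx; rewrite gv -mulrA gw mulrA => /spin_mulI <-.
exact: clifford_vecM_coef.
Qed.

End SpinElements.

(** * Two morphisms that are conjugate only elementwise *)

Theorem proposition1p1 (R : realType) (n : nat) (hn : (7 <= n)%N) :
  ~ acceptable_group (Spin R n) /\
  exists (Gamma : groupType) (r r' : {multiplicative Gamma -> Spin R n}),
    elementwise_conjugate r r' /\ ~ globally_conjugate r r'.
Proof.
set P := (X in _ /\ X); suff hP : P.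
  split=> // acc; have [Gamma [r [r' rr']]] := hP.
  by apply: (acc Gamma r); exists r'.
rewrite {}/P.
pose i (k : 'I_7) : 'I_n := widen_ord hn k.
pose e k := clifford_gen R (i k).
have neq (j k : 'I_7) : j != k -> i j != i k by [].
pose x := e 0 * e 1; pose y := e 2 * e 3; pose z := e 4 * e 5.
have xx : x * x = -1 by apply: clifford_pair_sqr; apply: neq.
have yy : y * y = -1 by apply: clifford_pair_sqr; apply: neq.
have zz : z * z = -1 by apply: clifford_pair_sqr; apply: neq.
have xy : GRing.comm x y by apply: clifford_pairs_comm; apply: neq.
have xz : GRing.comm x z by apply: clifford_pairs_comm; apply: neq.
have yz : GRing.comm y z by apply: clifford_pairs_comm; apply: neq.
have [a aE] : exists a : Spin R n, val a = turn x y z.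
  by apply: spin_turn; apply: neq.
have [b bE] : exists b : Spin R n, val b = y by apply: spin_pair.
have aa : val (a * a)%g = - (x * y) by rewrite /= aE turn_sqr.
have cab : commute a b.
  have yr : GRing.comm y (turn x y z) by apply: turn_comm => //; apply/commr_sym.
  by apply/val_inj; rewrite /= aE bE yr.
have b4 : (b ^+ 4 = 1)%g.
  by apply/val_inj; rewrite /= bE yy mulrN1 mulrN yy opprK.
have a4 : (a ^+ 4 = 1)%g.
  have -> : (a ^+ 4 = (a * a) * (a * a))%g.
    by rewrite -[(a * a)%g]expg2 -expgnDr.
  apply/val_inj; change (val (a * a)%g * val (a * a)%g = 1).
  by rewrite aa mulrNN -mulrA [y * _]mulrA -xy -mulrA yy mulrN1 mulrN xx opprK.
have bV : val (b^-1)%g = - y.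
  have -> : (b^-1 = b * (b * b))%g by apply: mulg1_eq; exact: b4.
  by rewrite /= bE yy mulrN1.
have bV4 : ((b^-1) ^+ 4 = 1)%g by rewrite expVgn b4 invg1.
(* For j = 0, 1, 2, 3, a^j b is y, a y, x, a x respectively. *)
have flip j : (j < 4)%N -> exists g : Spin R n,
    val g * (val (a ^+ j)%g * y) = - (val (a ^+ j)%g * y * val g).
  have [g0 g0E] := spin_pair R (i 0) (i 6).
  have [g2 g2E] := spin_pair R (i 2) (i 6).
  have [g4 g4E] := spin_pair R (i 4) (i 6).
  have g4a : val g4 * val a = - (val a * val g4).
    rewrite g4E aE; apply: turn_anticomm.
    - by apply: clifford_pairs_comm; apply: neq.
    - by apply: clifford_pairs_comm; apply: neq.
    - by apply: clifford_pairs_anticomm; apply: neq.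
  have aay : val (a * a)%g * y = x.
    by rewrite aa mulNr -mulrA yy mulrN1 opprK.
  case: j => [|[|[|[|j]]]] // _.
  - exists g2; rewrite !mul1r g2E.
    by apply: clifford_pairs_anticomm; apply: neq.
  - exists g4; apply: anti_comm => //; rewrite g4E.
    by apply: clifford_pairs_comm; apply: neq.
  - exists g0; rewrite [(a ^+ 2)%g]/(a * a)%g aay g0E.
    by apply: clifford_pairs_anticomm; apply: neq.
  - have -> : val (a ^+ 3)%g * y = val a * x by rewrite -aay [RHS]mulrA.
    exists g4.
    apply: anti_comm => //; rewrite g4E.
    by apply: clifford_pairs_comm; apply: neq.
exists ('I_4 * 'I_4)%type, (pair_hom cab a4 b4),
  (pair_hom (commuteV cab) a4 bV4).
split=> [c|[g gr]].
  apply: conjugate_pair_hom => // j /flip[g gE].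
  apply: (@conjugateP _ _ _ g); apply/val_inj; rewrite /= bE.
  by rewrite [val (b^-1)%g]bV gE mulrN mulNr.
have := gr (1, 0); have := gr (0, 1).
rewrite /= /pair_map /= !expg0 !expg1 !mulg1 !mul1g => gb ga.
have {}ga : GRing.comm (val g) (turn x y z).
  rewrite -aE; apply/esym; change (val (a * g)%g = val (g * a)%g).
  by rewrite {1}ga mulgVK.
have {}gb : val g * y = - (y * val g).
  rewrite -mulNr -bV -bE; change (val (g * b)%g = val (b^-1 * g)%g).
  by rewrite gb mulgVK.
have gz := turn_flip xx yy zz xy xz yz ga gb.
have inj_i : injective (fun k : 'I_6 => i (widen_ord (isT : (6 <= 7)%N) k)).
  by move=> j k /(congr1 val)/= /val_inj.
have [S S2 /eqP[]] := clifford_gen6_coef R inj_i.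
apply: (spin_pair_swap (g := g) (i := i 4) (j := i 5) (S := S)) => //.
rewrite -[X in X = _]/(val g * z) gz; congr (_ * _).
by rewrite /x /y /z /e; do !congr (_ * _); congr clifford_gen; apply/val_inj.
Qed.
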